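(* Let $N=(G=(V,E),\sigma,u,s)$ be a skew-symmetric network. Then the maximum value of an IS-flow in $N$ equals the minimum capacity $u(\mathcal B)$ over all odd $s$-barriers $\mathcal B$ for $(G,u)$.
   Context: A skew-symmetric graph is a finite directed graph $G=(V,E)$ (parallel arcs allowed) with a map $\sigma$ of $V\cup E$ onto itself such that $\sigma(x)\ne x$, $\sigma(\sigma(x))=x$ for all $x$, $\sigma(V)=V$, and for each arc $a$ from $v$ to $w$, $\sigma(a)$ is an arc from $\sigma(w)$ to $\sigma(v)$. A function on $E$ is symmetric if it takes equal values on $a$ and $\sigma(a)$. A skew-symmetric network is $N=(G,\sigma,u,s)$ with $u:E\to\mathbb Z_{\ge0}$ symmetric and source $s$; $s'=\sigma(s)$. A flow is $f:E\to\mathbb R_{\ge0}$ with $f\le u$ and flow conservation at each node other than $s,s'$; its value is the net outflow at $s$. An IS-flow is an integer-valued symmetric flow. For $X,Y\subseteq V$, $u(X,Y)$ denotes the total capacity of arcs from $X$ to $Y$. An odd $s$-barrier is a tuple $\mathcal B=(A;X_1,\dots,X_k)$ ($k\ge0$) such that: (O1) $A,X_1,\dots,X_k$ are pairwise disjoint subsets of $V$ and $s\in A$; (O2) $A\cap\sigma(A)=\emptyset$; (O3) $\sigma(X_i)=X_i$ for each $i$; (O4) $u(A,X_i)$ is odd for each $i$; (O5) for $i\neq j$ no arc of positive capacity connects $X_i$ and $X_j$ (in either direction); (O6) with $M:=V\setminus(A\cup\sigma(A)\cup X_1\cup\dots\cup X_k)$, no arc of positive capacity connects $X_i$ and $M$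 for any $i$. Its capacity is $u(\mathcal B):=u(A,V\setminus A)-k$. *)

(* Defs.v *)
From mathcomp Require Import all_boot all_order all_algebra.
Set Implicit Arguments. Unset Strict Implicit. Unset Printing Implicit Defensive.
Import Order.TTheory GRing.Theory Num.Theory.

(* A finite directed multigraph: node type V, arc type E, arc a goes from
   tl a to hd a.  sv / se are the skew-symmetry map on nodes / arcs. *)
Definition skew_symmetric (V E : finType) (tl hd : E -> V)
    (sv : V -> V) (se : E -> E) : Prop :=
  (forall v, sv v != v) /\ (forall v, sv (sv v) = v) /\
  (forall a, se a != a) /\ (forall a, se (se a) = a) /\
  (forall a, tl (se a) = sv (hd a) /\ hd (se a) = sv (tl a)).

Definition symmetric_fun (E : finType) (T : Type) (se : E -> E) (g : E -> T) : Prop :=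
  forall a, g (se a) = g a.

Definition ucap (V E : finType) (tl hd : E -> V) (u : E -> nat) (X Y : {set V}) : nat :=
  \sum_(a : E | (tl a \in X) && (hd a \in Y)) u a.

(* An IS-flow: integer-valued (hence nat-valued, being nonnegative) symmetric flow. *)
Definition is_IS_flow (V E : finType) (tl hd : E -> V) (sv : V -> V) (se : E -> E)
    (u : E -> nat) (s : V) (f : E -> nat) : Prop :=
  (forall a, f a <= u a) /\
  symmetric_fun se f /\
  (forall v, v != s -> v != sv s ->
     \sum_(a : E | hd a == v) f a = \sum_(a : E | tl a == v) f a).

Definition flow_value (V E : finType) (tl hd : E -> V) (s : V) (f : E -> nat) : int :=
  (\sum_(a : E | tl a == s) f a)%:Z - (\sum_(a : E | hd a == s) f a)%:Z.

Definition pos_connects (V E : finType) (tl hd : E -> V) (u : E -> nat) (X Y : {set V}) : bool :=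
  [exists a : E, (0 < u a) &&
     (((tl a \in X) && (hd a \in Y)) || ((tl a \in Y) && (hd a \in X)))].

Definition is_odd_barrier (V E : finType) (tl hd : E -> V) (sv : V -> V)
    (u : E -> nat) (s : V) (A : {set V}) (k : nat) (X : 'I_k -> {set V}) : Prop :=
  let M := ~: (A :|: (sv @: A) :|: \bigcup_(i < k) X i) in
  s \in A /\ (forall i, [disjoint A & X i]) /\
  (forall i j : 'I_k, i != j -> [disjoint X i & X j]) /\
  [disjoint A & sv @: A] /\
  (forall i, sv @: X i = X i) /\
  (forall i, odd (ucap tl hd u A (X i))) /\
  (forall i j : 'I_k, i != j -> ~~ pos_connects tl hd u (X i) (X j)) /\
  (forall i, ~~ pos_connects tl hd u (X i) M).

Definition barrier_cap (V E : finType) (tl hd : E -> V) (u : E -> nat)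
    (A : {set V}) (k : nat) : int :=
  (ucap tl hd u A (~: A))%:Z - k%:Z.

(* Main.v *)
Require Import Defs.
From mathcomp Require Import all_boot all_order all_algebra.
From mathcomp Require Import zify ring.
Import Order.TTheory GRing.Theory Num.Theory.
Set Implicit Arguments. Unset Strict Implicit. Unset Printing Implicit Defensive.

(** Replacing each arc by its residual unit copies, a regular walk from [s] to
    [sv s] (one using no arc twice and no arc together with its mate) augments
    an IS-flow by 2, so everything reduces to unit capacities: if there is no
    regular walk, there is an odd barrier of capacity 0.  Moreover the residual
    capacity of (A, X_i) has the parity of u(A, X_i), by conservation on one
    half of X_i.  This gives weak duality, and makes a barrier of capacity 0 in
    the residual graph a tight one in the network.

    The unit case goes by induction on the number of arcs, using one arc e from
    s to t.  Contract t into s (and its mate t' into s'), deleting e and its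
    mate.  A barrier of the contracted graph lifts; a regular walk lifts too,
    unless it becomes a walk from t to t'.  In that case its vertices and their
    mates form a set Y, entered through e, such that any vertex of Y is
    reached from t by a regular walk inside Y.  Shrink Y to the pair {t, t'},
    leaving e as the only arc into t: regular walks and barriers both lift. *)

(** * Walks and regular walks in a directed multigraph *)

Section Walks.

Context {V E : finType}.
Implicit Types (tl hd : E -> V) (p q : seq E) (x y z : V).

Fixpoint walk tl hd x p y : bool :=
  if p is a :: q then (tl a == x) && walk tl hd (hd a) q y else x == y.

Lemma walk_cat tl hd x y z p q :
  walk tl hd x p y -> walk tl hd y q z -> walk tl hd x (p ++ q) z.
Proof.
elim: p x => [x /eqP -> //|a p IHp x /= /andP[-> wp] wq]; exact: IHp wp wq.
Qed.

Lemma walk_split tl hd x z p q :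
  walk tl hd x (p ++ q) z -> exists2 y, walk tl hd x p y & walk tl hd y q z.
Proof.
elim: p x => [x wq|a p IHp x /= /andP[-> /IHp[y wp wq]]]; first by exists x => /=.
by exists y.
Qed.

Lemma walk_vertices tl hd x y p :
  walk tl hd x p y -> x :: map hd p = rcons (map tl p) y.
Proof. by elim: p x => [x /eqP -> //|a p IHp x /= /andP[/eqP-> /IHp ->]]. Qed.

(** Cut at the last visit to [x]. *)
Lemma walk_cut_start tl hd x y p : walk tl hd x p y ->
  exists p1 p2, [/\ p = p1 ++ p2, walk tl hd x p2 y & x \notin map hd p2].
Proof.
suff gen z : walk tl hd z p y -> (x \notin map hd p) \/
    exists p1 p2, [/\ p = p1 ++ p2, walk tl hd x p2 y & x \notin map hd p2].
  by move=> wp; case: (gen x wp) => // xp; exists [::], p.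
elim: p z => [|a p IHp] z /=; first by left.
case/andP=> _ wp; have [xp|[p1 [p2 [-> w2 xp2]]]] := IHp _ wp; last first.
  by right; exists (a :: p1), p2.
have [xa|xa] := eqVneq x (hd a); last by left; rewrite inE negb_or xa.
by right; exists [:: a], p; rewrite {1}xa.
Qed.

(** Cut at the first visit to [y]. *)
Lemma walk_cut_end tl hd x y p : walk tl hd x p y ->
  exists p1 p2, [/\ p = p1 ++ p2, walk tl hd x p1 y & y \notin map tl p1].
Proof.
elim: p x => [|a p IHp] x /=; first by exists [::], [::].
have [-> _|xy] := eqVneq x y; first by exists [::], (a :: p); rewrite /= eqxx.
case/andP=> /eqP ax /IHp[p1 [p2 [-> w1 yp1]]]; exists (a :: p1), p2.
by rewrite /= ax eqxx w1 inE eq_sym (negPf xy).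
Qed.

Definition regular (se : E -> E) p := uniq p && all (fun a => se a \notin p) p.

Lemma regularP se p :
  reflect (uniq p /\ forall a, a \in p -> se a \notin p) (regular se p).
Proof. by apply: (iffP andP) => -[up /allP]. Qed.

Lemma regular_subseq se p q : subseq q p -> regular se p -> regular se q.
Proof.
move=> sqp /regularP[up rp]; apply/regularP; split; first exact: subseq_uniq up.
move=> a /(mem_subseq sqp)/rp; apply: contra; exact: mem_subseq.
Qed.

Lemma regular_mate se p : involutive se -> regular se p ->
  regular se (rev (map se p)).
Proof.
move=> seK /regularP[up rp]; apply/regularP; split.
  by rewrite rev_uniq map_inj_uniq //; apply: inv_inj.
move=> a; rewrite !mem_rev => /mapP[b bp ->].
by rewrite mem_map ?rp //; apply: inv_inj.
Qed.

Lemma walk_mate tl hd (sv : V -> V) se x y p :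
  (forall a, tl (se a) = sv (hd a) /\ hd (se a) = sv (tl a)) ->
  walk tl hd x p y -> walk tl hd (sv y) (rev (map se p)) (sv x).
Proof.
move=> skew_ends; elim: p x => [x /eqP -> /=|a p IHp x /= /andP[/eqP<- /IHp wp]] //.
rewrite rev_cons -cats1; apply: walk_cat wp _ => /=.
by case: (skew_ends a) => -> ->; rewrite !eqxx.
Qed.

End Walks.

(** * Unit capacities: a regular walk or a barrier of capacity 0 *)

Section Reachability.

Variables (V E : finType) (sv : V -> V) (se : E -> E) (s : V).
Hypothesis svN : forall v, sv v != v.
Hypothesis svK : involutive sv.
Hypothesis seN : forall a, se a != a.
Hypothesis seK : involutive se.
Implicit Types (tl hd : E -> V) (D : {set E}).

Definition skew_ends tl hd := forall a, tl (se a) = sv (hd a) /\ hd (se a) = sv (tl a).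

Definition augmenting tl hd D p :=
  [/\ walk tl hd s p (sv s), regular se p & {subset p <= D}].

(* The blocks are the classes of the labelling [l] on the complement of A and
   its mate.  A block need not be entered from A, so that M is itself a union of
   blocks; the X_i are the entered ones. *)
Definition weak_barrier tl hd D (A : pred V) (l : V -> nat) :=
  let N v := ~~ A v && ~~ A (sv v) in
  [/\ A s /\ (forall v, A v -> ~~ A (sv v)),
      (forall a, a \in D -> A (tl a) -> ~~ A (sv (hd a))),
      (forall a, a \in D -> N (tl a) -> N (hd a) -> l (tl a) = l (hd a)),
      (forall v, N v -> l (sv v) = l v) &
      (forall a b, a \in D -> b \in D -> A (tl a) -> A (tl b) ->
         N (hd a) -> N (hd b) -> l (hd a) = l (hd b) -> a = b)].

Definition dichotomy tl hd D :=
  (exists p, augmenting tl hd D p) \/ exists A l, weak_barrier tl hd D A l.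

Lemma sv_eq x y : (sv x == sv y) = (x == y).
Proof. exact: (inj_eq (inv_inj svK)). Qed.

Lemma sv_eqL x y : (sv x == y) = (x == sv y).
Proof. by rewrite -sv_eq svK. Qed.

(** Take [A] to be [s] alone: no arc of [D] leaves it, so one label suffices for everything else. *)
Lemma dichotomy_isolated tl hd D : skew_ends tl hd ->
  (forall a, a \in D -> tl a = s -> hd a = s) -> dichotomy tl hd D.
Proof.
move=> sk iso; right; exists (pred1 s), (fun=> 0); split => //=.
- by split=> // v /eqP ->.
- by move=> a aD /eqP/(iso a aD) ->.
- by move=> a b aD _ /eqP/(iso a aD) ->; rewrite eqxx.
Qed.

Section Step.

Variables (tl hd : E -> V) (D : {set E}) (e : E).
Hypothesis sk : skew_ends tl hd.
Hypothesis DS : forall a, (se a \in D) = (a \in D).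
Hypothesis eD : e \in D.
Hypothesis tle : tl e = s.
Let t := hd e.
Hypothesis tNs : t != s.
Hypothesis tNs' : t != sv s.

Let tlS a : tl (se a) = sv (hd a). Proof. by case: (sk a). Qed.
Let hdS a : hd (se a) = sv (tl a). Proof. by case: (sk a). Qed.
Let svs : sv s != s := svN s.

(** * Contracting the arc [e] *)

Section Contract.

Let phi v := if v == t then s else if v == sv t then sv s else v.
Let D1 := D :\ e :\ se e.

Let phi_sv v : phi (sv v) = sv (phi v).
Proof.
rewrite /phi sv_eq sv_eqL; case: (eqVneq v t) => [->|_] //.
  by rewrite eq_sym (negPf (svN t)).
by case: (eqVneq v (sv t)) => _; rewrite ?svK.
Qed.

Lemma contract_skew : skew_ends (phi \o tl) (phi \o hd).
Proof. by move=> a /=; rewrite tlS hdS !phi_sv. Qed.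

Lemma contract_symm a : (se a \in D1) = (a \in D1).
Proof.
by rewrite !inE DS (inj_eq (inv_inj seK)) (can2_eq seK seK); do ![case: eqP] => // *.
Qed.

Lemma contract_card : #|D1| < #|D|.
Proof.
apply/proper_card/properP; split.
  by rewrite !subDset; apply/subsetP=> a; rewrite !inE => ->; rewrite !orbT.
by exists e => //; rewrite !inE eqxx andbF.
Qed.

(** Under [phi], [e] becomes a loop at [s] and [se e] a loop at [sv s], so putting them back
    violates no clause of the pulled-back barrier. *)
Lemma contract_barrier A l : weak_barrier (phi \o tl) (phi \o hd) D1 A l ->
  weak_barrier tl hd D (A \o phi) (l \o phi).
Proof.
have D1P a : a \in D -> [\/ a = e, a = se e | a \in D1].
  move=> aD; rewrite !inE aD andbT.
  case: (eqVneq a e) => [->|_]; first by constructor 1.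
  by case: (eqVneq a (se e)) => [->|_]; [constructor 2 | constructor 3].
have phis : phi s = s.
  by rewrite /phi eq_sym (negPf tNs) -sv_eqL eq_sym (negPf tNs').
have phit : phi t = s by rewrite /phi eqxx.
move=> [[As AA] B1 B2 B3 B4]; have As' := AA s As.
split=> /=.
- by rewrite phis; split=> // v; rewrite phi_sv; apply: AA.
- move=> a /D1P[->|->|]; rewrite ?tlS ?hdS ?phi_sv ?svK ?tle ?phis ?phit //=.
  + by rewrite (negPf As').
  + exact: B1.
- move=> a /D1P[->|->|aD]; rewrite ?tlS ?hdS ?phi_sv ?svK ?tle ?phis ?phit ?As //.
  exact: B2.
- by move=> v; rewrite phi_sv; apply: B3.
- move=> a b /D1P[->|->|aD] /D1P[->|->|bD];
   rewrite ?tlS ?hdS ?phi_sv ?svK ?tle ?phis ?phit ?As ?(negPf As') ?andbF //.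
  exact: B4.
Qed.

(** Away from the values [s] and [sv s] the map [phi] is injective, so consecutive arcs already meet
    before contraction; only the two ends of the walk stay ambiguous. *)
Lemma contract_walk x p y : walk (phi \o tl) (phi \o hd) x p y -> p != [::] ->
  s \notin map (phi \o hd) p -> sv s \notin map (phi \o tl) p ->
  exists x0 y0, [/\ phi x0 = x, phi y0 = y & walk tl hd x0 p y0].
Proof.
elim: p x => //= a [|b q] IHp x /andP[/eqP<- wp] _.
  by move=> _ _; exists (tl a), (hd a); rewrite /= !eqxx; move/eqP: wp.
rewrite inE negb_or => /andP[sa sq]; rewrite inE negb_or => /andP[sa' sq'].
have [x0 [y0 [ex ey w0]]] := IHp _ wp isT sq sq'.
exists (tl a), y0; rewrite eqxx; split=> //; suff -> : hd a = x0 by [].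
have phi_inj v w : phi v = phi w -> s != phi v -> sv s != phi v -> v = w.
  have phiE z : [\/ phi z = s, phi z = sv s | phi z = z].
    rewrite /phi; case: eqP => _; first by constructor 1.
    by case: eqP => _; [constructor 2 | constructor 3].
  by move=> vw /eqP ns /eqP ns'; case: (phiE v); case: (phiE w); congruence.
case/andP: w0 => /eqP bx _; move: sq' ex sa; rewrite -bx inE negb_or => /andP[sb _] ex sa.
by apply: (phi_inj _ _ (esym ex) sa); rewrite -ex.
Qed.

End Contract.

(** * Shrinking the vertex set of a regular walk from [t] to [sv t] *)

Section Shrink.

Variable r : seq E.
Hypothesis wr : walk tl hd t r (sv t).
Hypothesis rr : regular se r.
Hypothesis rD : {subset r <= D}.
Hypothesis sNr : s \notin map hd r.
Hypothesis sNr' : sv s \notin map tl r.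

Let vs := t :: map hd r.
Let Y : pred V := fun v => (v \in vs) || (sv v \in vs).
(** Arcs out of [Y] start at [t] and arcs into [Y] end at [sv t], with [e] and its mate as the only
    exceptions. Hence a walk entering [Y] otherwise than by [e] is at [sv t], which it can leave
    only by [se e]. *)
Let tl2 a := if Y (tl a) && (a != se e) then t else tl a.
Let hd2 a := if Y (hd a) && (a != e) then sv t else hd a.
Let D2 := [set a in D | ~~ (Y (tl a) && Y (hd a))].

Let YS v : Y (sv v) = Y v. Proof. by rewrite /Y svK orbC. Qed.
Let Yt : Y t. Proof. by rewrite /Y inE eqxx. Qed.

Let walk_ends : vs = rcons (map tl r) (sv t).
Proof. exact: walk_vertices wr. Qed.

Let NYs : ~~ Y s.
Proof.
rewrite /Y {1}/vs walk_ends inE mem_rcons inE !negb_or sNr' (negPf sNr).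
by rewrite eq_sym tNs sv_eq eq_sym tNs.
Qed.

Lemma shrink_skew : skew_ends tl2 hd2.
Proof.
move=> a; rewrite /tl2 /hd2 tlS hdS !YS !(inj_eq (inv_inj seK)) (can2_eq seK seK).
by split; case: ifP; rewrite ?svK.
Qed.

Lemma shrink_symm a : (se a \in D2) = (a \in D2).
Proof. by rewrite !inE DS tlS hdS !YS andbC [Y (hd a) && _]andbC andbC. Qed.

Let r_inside a : a \in r -> Y (tl a) && Y (hd a).
Proof.
move=> ar; rewrite /Y {1}walk_ends mem_rcons [_ \in _ :: map tl r]inE.
by rewrite map_f // [hd a \in vs]inE map_f // !orbT.
Qed.

(** As [t] differs from [sv t], the walk [r] has a first arc; it lies inside [Y] and is dropped. *)
Lemma shrink_card : #|D2| < #|D|.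
Proof.
apply/proper_card/properP; split; first by apply/subsetP=> a; rewrite inE => /andP[].
case: (r) wr r_inside rD => [/eqP /esym/eqP|a q _ ins sub]; first by rewrite (negPf (svN t)).
by exists a; [apply: sub | rewrite inE ins]; rewrite ?inE ?eqxx ?andbF.
Qed.

Let hd_se_e : hd (se e) = sv s. Proof. by rewrite hdS tle. Qed.

Let tl2_eq_sv a : tl2 a = sv t -> a = se e.
Proof.
rewrite /tl2; case: eqVneq => // _; rewrite andbT; case: ifP => [_ /esym/eqP|+ ta].
  by rewrite (negPf (svN t)).
by rewrite ta YS Yt.
Qed.

(** A vertex on [r] is reached by a prefix of [r]. If only its mate is on [r], a prefix of the mate
    of [r] serves, which is again a regular walk from [t] to [sv t]. *)
Lemma inner_walk y : Y y ->
  exists q, [/\ walk tl hd t q y, regular se q, {subset q <= D} &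
                {in q, forall a, Y (tl a) && Y (hd a)}].
Proof.
have pre q : walk tl hd t q (sv t) -> regular se q -> {subset q <= D} ->
    {in q, forall a, Y (tl a) && Y (hd a)} -> y \in t :: map hd q ->
  exists q, [/\ walk tl hd t q y, regular se q, {subset q <= D} &
                {in q, forall a, Y (tl a) && Y (hd a)}].
  move=> wq rq qD qY; rewrite inE => /predU1P[->|]; first by exists [::]; split=> //=.
  case/mapP=> a /splitPr aq ->; case: aq wq rq qD qY => q1 q2.
  rewrite -cat_rcons => wq rq qD qY; exists (rcons q1 a); split.
  - have [z w1 _] := walk_split wq; move: w1.
    rewrite -cats1 => /walk_split[x w1 /= /andP[ax _]].
    by apply: walk_cat w1 _; rewrite /= ax eqxx.
  - by apply: regular_subseq rq; apply: prefix_subseq.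
  - by move=> b bq; apply: qD; rewrite mem_cat bq.
  - by move=> b bq; apply: qY; rewrite mem_cat bq.
case/orP=> [yv|yv]; first exact: (pre r).
apply: (pre (rev (map se r))).
- by have := walk_mate sk wr; rewrite svK.
- exact: regular_mate.
- by move=> a; rewrite mem_rev => /mapP[b br ->]; rewrite DS rD.
- by move=> a; rewrite mem_rev => /mapP[b br ->]; rewrite tlS hdS !YS andbC r_inside.
- move: yv; rewrite walk_ends mem_rcons !inE sv_eq; case: eqP => //= _.
  case/mapP=> a ar /eqP; rewrite sv_eqL => /eqP->.
  by rewrite -hdS map_f // mem_rev map_f.
Qed.

(** Entering [Y] would strand the walk at [sv t], which is not its end; so it avoids [Y], where
    shrinking changes nothing. *)
Lemma unshrink_walk x p : walk tl2 hd2 x p (sv s) -> e \notin p -> se e \notin p ->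
  ~~ Y x -> walk tl hd x p (sv s).
Proof.
elim: p x => //= a p IHp x /andP[/eqP ax wp] + + Yx; rewrite !inE !negb_or.
case/andP=> ae ep /andP[ae' ep'].
have Ya : ~~ Y (tl a).
  by apply: contra Yx => Ya; rewrite -ax /tl2 Ya eq_sym ae' Yt.
move: ax wp; rewrite /tl2 (negPf Ya) /= => -> ; rewrite eqxx /hd2 [a == e]eq_sym ae andbT.
case: ifP => [_|/negbT Yh wp]; last exact: IHp.
case: (p) ep' => [|b q] /=; first by rewrite sv_eq (negPf tNs).
by rewrite inE negb_or => /andP[be' _] /andP[/eqP/tl2_eq_sv be]; rewrite be eqxx in be'.
Qed.

(** The part of the walk before [e] is dropped. The arc [a] after [e] leaves [Y], since [D2] has no
    arc inside [Y], and the rest never returns. An inner walk from [t] to [tl a] fills the gap; its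
    arcs lie inside [Y] and the others do not, so regularity survives. *)
Let lift_through p : walk tl2 hd2 s p (sv s) -> regular se p -> {subset p <= D2} ->
  e \in p -> exists p, augmenting tl hd D p.
Proof.
move=> wp rp pD ep; case/splitPr: ep wp rp pD => p1 p2 wp rp pD.
have {wp}[x _ wp] := walk_split wp.
have {rp}rp : regular se (e :: p2) by apply: regular_subseq rp; apply: suffix_subseq.
have {}pD : {subset e :: p2 <= D2} by move=> a ap; apply: pD; rewrite mem_cat ap orbT.
move: wp => /= /andP[_]; rewrite [hd2 e]/hd2 eqxx andbF.
have /regularP[/=/andP[ep up] mp] := rp.
have ep' : se e \notin p2.
  by have := mp e; rewrite !inE eqxx => /(_ isT); rewrite negb_or => /andP[].
case: p2 => [|a p3] in rp pD ep up mp ep' *; first by rewrite /= (negPf tNs').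
move=> /= /andP[/eqP ta wp].
have ae' : a != se e by apply: contraNneq ep' => ->; rewrite inE eqxx.
have ae : a != e by apply: contraNneq ep => ->; rewrite inE eqxx.
have Yta : Y (tl a) by move: ta; rewrite /tl2 ae' andbT; case: ifP => // <- ->.
have Yha : ~~ Y (hd a).
  by have := pD a; rewrite !inE eqxx orbT Yta => /(_ isT) /andP[].
have w3 : walk tl hd (hd a) p3 (sv s).
  move: wp; rewrite /hd2 (negPf Yha) => /unshrink_walk; apply=> //.
  - by apply: contra ep; rewrite inE orbC => ->.
  - by apply: contra ep'; rewrite inE orbC => ->.
have [q [wq rq qD qY]] := inner_walk Yta.
have out b : b \in [:: e, a & p3] -> ~~ (Y (tl b) && Y (hd b)).
  by move/pD; rewrite inE => /andP[].
exists (e :: q ++ a :: p3); split.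
- by rewrite /= tle eqxx; apply: walk_cat wq _; rewrite /= eqxx.
- have /regularP[uq mq] := rq; have /regularP[ue me] := rp.
  have eqv : perm_eq (e :: q ++ a :: p3) (q ++ [:: e, a & p3]).
    by rewrite -cat1s perm_catCA.
  apply/regularP; split.
    rewrite (perm_uniq eqv) cat_uniq uq ue andbT; apply/hasPn=> b /out.
    by apply: contra => /qY.
  move=> b; rewrite !(perm_mem eqv) !mem_cat negb_or => /orP[bq|bp].
    rewrite mq //=; apply/negP=> /out; rewrite tlS hdS !YS andbC.
    by rewrite qY.
  rewrite me // andbT; apply/negP=> /qY; rewrite tlS hdS !YS andbC.
  by apply/negP/out.
- move=> b; rewrite inE mem_cat => /predU1P[->//|/orP[/qD //|bp]].
  by have := pD b; rewrite inE bp orbT inE => /(_ isT) /andP[].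
Qed.

(** If the walk uses [se e], its mate uses [e]. *)
Lemma shrink_augmenting p :
  augmenting tl2 hd2 D2 p -> exists p, augmenting tl hd D p.
Proof.
case=> wp rp pD.
have [ep|ep] := boolP (e \in p); first exact: lift_through ep.
have [ep'|ep'] := boolP (se e \in p); last first.
  exists p; split=> //; first exact: unshrink_walk.
  by move=> a /pD; rewrite inE => /andP[].
apply: (@lift_through (rev (map se p))).
- by have := walk_mate shrink_skew wp; rewrite svK.
- exact: regular_mate.
- by move=> a; rewrite mem_rev => /mapP[b bp ->]; rewrite shrink_symm pD.
- by rewrite mem_rev -[e]seK map_f.
Qed.

Let D2P a : a \in D -> Y (tl a) && Y (hd a) \/ a \in D2.
Proof. by move=> aD; rewrite inE aD /=; case: (_ && _); [left | right]. Qed.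

Let eD2 : e \in D2. Proof. by rewrite inE eD tle (negPf NYs). Qed.

Let e2 : (tl2 e = s) * (hd2 e = t).
Proof. by rewrite /tl2 /hd2 eqxx andbF tle (negPf NYs). Qed.

Let e2' : (tl2 (se e) = sv t) * (hd2 (se e) = sv s).
Proof. by have [t2 h2] := shrink_skew e; rewrite t2 h2 !e2. Qed.

Let tl2_out a : ~~ Y (tl a) -> tl2 a = tl a.
Proof. by rewrite /tl2 => /negPf->. Qed.

Let hd2_out a : ~~ Y (hd a) -> hd2 a = hd a.
Proof. by rewrite /hd2 => /negPf->. Qed.

Let tl2_in a : Y (tl a) -> tl2 a = t \/ a = se e.
Proof. by rewrite /tl2 => ->; case: eqVneq; [right | left]. Qed.

Let hd2_in a : Y (hd a) -> hd2 a = sv t \/ a = e.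
Proof. by rewrite /hd2 => ->; case: eqVneq; [right | left]. Qed.

(** Here [t] and its mate lie in one block, because [e] keeps [sv t] out of [A] as well. All of [Y]
    can join that block, by pulling back along the map [psi] that collapses [Y] to [t]. *)
Lemma shrink_barrier_outside A l : weak_barrier tl2 hd2 D2 A l ->
  ~~ A t -> exists A l, weak_barrier tl hd D A l.
Proof.
case=> -[As AA] B1 B2 B3 B4 At.
have At' : ~~ A (sv t) by move: (B1 _ eD2); rewrite !e2; apply.
pose psi v := if Y v then t else v.
have psiY v : Y v -> psi v = t by rewrite /psi => ->.
have psiN v : ~~ Y v -> psi v = v by rewrite /psi => /negPf->.
have psiA v : A (psi (sv v)) = A (sv (psi v)).
  by rewrite /psi YS; case: ifP; rewrite // (negPf At) (negPf At').
have lt' : l (sv t) = l t by apply: B3; rewrite At At'.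
have Aout v : A (psi v) -> ~~ Y v by apply: contraTN => /psiY->.
have tl2E a : l (tl2 a) = l (psi (tl a)) /\ A (tl2 a) = A (psi (tl a)).
  have [Ya|Ya] := boolP (Y (tl a)); last by rewrite psiN ?tl2_out.
  rewrite psiY //; case: (tl2_in Ya) => [->//|->]; rewrite !e2'.
  by rewrite lt' (negPf At) (negPf At').
have hd2E a : l (hd2 a) = l (psi (hd a)) /\ A (hd2 a) = A (psi (hd a)).
  have [Ya|Ya] := boolP (Y (hd a)); last by rewrite psiN ?hd2_out.
  rewrite psiY //; case: (hd2_in Ya) => [->|->]; rewrite ?e2 //.
  by rewrite lt' (negPf At) (negPf At').
have tl2E' a : A (sv (tl2 a)) = A (sv (psi (tl a))).
  have [_] := hd2E (se a); case: (shrink_skew a) => _ ->.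
  by rewrite hdS psiA.
have hd2E' a : A (sv (hd2 a)) = A (sv (psi (hd a))).
  have [_] := tl2E (se a); case: (shrink_skew a) => -> _.
  by rewrite tlS psiA.
exists (A \o psi), (l \o psi); split=> /=.
- split=> [|v]; first by rewrite psiN.
  by rewrite psiA; apply: AA.
- move=> a /D2P[/andP[Ya _]|aD]; first by rewrite (psiY _ Ya) (negPf At).
  by rewrite psiA -hd2E' -(tl2E a).2; apply: B1.
- move=> a /D2P[/andP[Ya Yb]|aD]; first by rewrite (psiY _ Ya) (psiY _ Yb).
  by rewrite !psiA -hd2E' -tl2E' -(tl2E a).2 -(hd2E a).2 -(tl2E a).1 -(hd2E a).1; apply: B2.
- move=> v; rewrite psiA /psi YS; case: ifP => // _; exact: B3.
- move=> a b aD bD Aa Ab.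
  have a2 : a \in D2 by case: (D2P aD) => // /andP[Ya]; rewrite (negPf (Aout _ Aa)) in Ya.
  have b2 : b \in D2 by case: (D2P bD) => // /andP[Yb]; rewrite (negPf (Aout _ Ab)) in Yb.
  rewrite !psiA -!hd2E' -(hd2E a).2 -(hd2E b).2 -(hd2E a).1 -(hd2E b).1.
  by apply: B4; rewrite ?(tl2E _).2.
Qed.

(* The label 0 is given to Y merged with all the blocks entered from t. *)
Lemma shrink_barrier_inside A l : weak_barrier tl2 hd2 D2 A l ->
  A t -> exists A l, weak_barrier tl hd D A l.
Proof.
case=> -[As AA] B1 B2 B3 B4 At; have At' := AA _ At.
pose N v := ~~ A v && ~~ A (sv v).
(* [J] marks the blocks entered from [t]; the shift by one in [l'] reserves 0 for the merged
   block. *)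
pose J k := [exists a in D2, [&& tl2 a == t, N (hd2 a) & l (hd2 a) == k]].
pose l' v := if Y v || J (l v) then 0 else (l v).+1.
pose A' v := A v && ~~ Y v.
have A'E v : A' (sv v) = A (sv v) && ~~ Y v by rewrite /A' YS.
have inD2 a : a \in D -> A' (tl a) -> a \in D2 /\ tl2 a = tl a.
  move=> /D2P[/andP[Ya _] /andP[_]|aD /andP[_ Ya]]; first by rewrite Ya.
  by rewrite tl2_out.
(* An arc from [Y] to another block starts at [t] after shrinking, the exception [se e] ending at
   [sv s]; so it stays within the merged block. *)
have exitJ a : a \in D -> Y (tl a) -> ~~ Y (hd a) -> N (hd a) -> J (l (hd a)).
  move=> aD Ya Yb Nb; apply/existsP; exists a; rewrite hd2_out // Nb eqxx.
  case: (D2P aD) => [/andP[_]|->]; first by rewrite (negPf Yb).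
  case: (tl2_in Ya) => [->|ae]; first by rewrite eqxx.
  by move: Nb; rewrite ae hd_se_e /N svK As andbF.
exists A', l'; split=> /=.
- rewrite /A' As NYs; split=> // v /andP[/AA Av _]; by rewrite (negPf Av).
- move=> a aD Aa; have [a2 ta] := inD2 a aD Aa; rewrite A'E.
  have [Ya|Ya] := boolP (Y (hd a)); first by rewrite andbF.
  by rewrite andbT -hd2_out // B1 // ta; case/andP: Aa.
- move=> a aD; rewrite !A'E /A' /l'.
  have [Ya|Ya] := boolP (Y (tl a)); have [Yb|Yb] := boolP (Y (hd a)); rewrite ?andbF ?andbT //=.
  + by move=> _ Nb; rewrite exitJ.
  + move=> Na _; have := @exitJ (se a); rewrite DS tlS hdS !YS B3 // => -> //.
    by rewrite /N svK andbC.
  + have [|a2] := D2P aD; first by rewrite (negPf Ya).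
    move=> Na Nb; have := B2 a a2; rewrite tl2_out // hd2_out // => -> //.
- move=> v; rewrite A'E /A' /l' YS; case: (boolP (Y v)) => //= _; rewrite !andbT.
  by move=> /B3 ->.
- move=> a b aD bD Aa Ab; have [a2 ta] := inD2 a aD Aa; have [b2 tb] := inD2 b bD Ab.
  (* Any other arc would run from [A] to [sv t], which [B1] forbids as [t] is in [A]. *)
  have into c : c \in D2 -> tl2 c = tl c -> A' (tl c) -> Y (hd c) -> c = e.
    move=> cD tc /andP[Ac _] /hd2_in[hc|//].
    by have := B1 c cD; rewrite tc Ac hc svK At => /(_ isT).
  (* A block marked by [J] already has its one entering arc, from [t]. So the merged block is
     entered by [e] alone. *)
  have outJ c : c \in D2 -> tl2 c = tl c -> A' (tl c) -> ~~ Y (hd c) -> N (hd c) ->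
      J (l (hd c)) = false.
    move=> cD tc /andP[Ac Yc] Yh Nh; apply/negbTE/exists_inPn => d dD.
    apply/negP => /and3P[/eqP td Nd /eqP ld].
    have dc : d = c by apply: B4; rewrite ?td ?tc ?(hd2_out Yh).
    by move: Yc; rewrite -tc -dc td Yt.
  rewrite !A'E /A' /l'.
  have [Ya|Ya] := boolP (Y (hd a)); have [Yb|Yb] := boolP (Y (hd b)); rewrite ?andbF ?andbT /=.
  + by rewrite (into a) // (into b).
  + by move=> _ Nb; rewrite outJ.
  + by move=> Na _; rewrite outJ.
  + move=> Na Nb; rewrite !outJ // => -[lab].
    by apply: B4; rewrite ?ta ?tb ?hd2_out //; [case/andP: Aa | case/andP: Ab].
Qed.

Lemma shrink_barrier A l : weak_barrier tl2 hd2 D2 A l ->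
  exists A l, weak_barrier tl hd D A l.
Proof.
move=> B; have [At|At] := boolP (A t); first exact: shrink_barrier_inside B At.
exact: shrink_barrier_outside B At.
Qed.

End Shrink.

(** * The induction step and the reachability theorem *)

Hypothesis IH : forall tl hd (D1 : {set E}), #|D1| < #|D| -> skew_ends tl hd ->
  (forall a, (se a \in D1) = (a \in D1)) -> dichotomy tl hd D1.

Lemma dichotomy_step : dichotomy tl hd D.
Proof.
have seNe : se e != e := seN e.
have [] := IH contract_card contract_skew contract_symm; last first.
  by case=> A [l B]; right; eexists; eexists; apply: contract_barrier B.
case=> p0 [w0 r0 p0D].
(* Trim the walk so that it meets [s] only at its start and [sv s] only at its end, as lifting
   requires. *)
have [q1 [p1 [ep0 w1 s1]]] := walk_cut_start w0.
have [p [q2 [ep1 w s2]]] := walk_cut_end w1.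
have sub : subseq p p0.
  rewrite ep0 ep1; apply: subseq_trans (suffix_subseq _ _); exact: prefix_subseq.
have sp : s \notin map (fun a => if hd a == t then s else if hd a == sv t then sv s else hd a) p.
  by apply: contra s1; rewrite ep1 map_cat mem_cat => ->.
have r := regular_subseq sub r0.
have pD1 a : a \in p -> [/\ a \in D, a != e & a != se e].
  by move/(mem_subseq sub)/p0D; rewrite !inE => /and3P[].
have pn : p != [::] by apply: contraTneq w => ->; rewrite /= eq_sym (negPf svs).
have [x [y [ex ey {}w]]] := contract_walk w pn sp s2.
have xE : x = s \/ x = t.
  move: ex; case: eqP => [|_]; [by right|]; case: eqP => [_ /eqP|]; last by left.
  by rewrite (negPf svs).
have yE : y = sv s \/ y = sv t.
  move: ey; case: eqP => [_ /esym/eqP|_]; first by rewrite (negPf svs).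
  by case: eqP => [|_]; [right | left].
have eNp : e \notin p by apply/negP=> /pD1[_]; rewrite eqxx.
have eNp' : se e \notin p by apply/negP=> /pD1[_ _]; rewrite eqxx.
have pD : {subset p <= D} by move=> a /pD1[].
have /regularP[up mp] := r.
have eN a : a \in p -> se a != e.
  by move=> ap; apply: contraNneq eNp' => <-; rewrite seK.
(* A start at [t] is repaired by prepending [e], an end at [sv t] by appending [se e]. Doing both
   would break regularity; that last case is the one for shrinking. *)
case: xE => xE; case: yE => yE; subst x y.
- by left; exists p.
- left; exists (rcons p (se e)); split.
  + by rewrite -cats1; apply: walk_cat w _; rewrite /= tlS hdS tle !eqxx.
  + apply/regularP; rewrite rcons_uniq eNp'; split=> // a.
    rewrite !mem_rcons !inE negb_or (inj_eq (inv_inj seK)) => /predU1P[->|ap].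
      by rewrite seNe seK.
    by rewrite mp // andbT; apply: contraNneq eNp => <-.
  + by move=> a; rewrite mem_rcons inE => /predU1P[->|/pD //]; rewrite DS.
- left; exists (e :: p); split.
  + by rewrite /= tle eqxx.
  + apply/regularP; rewrite /= eNp; split=> // a.
    rewrite !inE negb_or => /predU1P[->|ap]; first by rewrite seNe.
    by rewrite mp // eN.
  + by move=> a; rewrite inE => /predU1P[->|/pD].
- have sp1 : s \notin map hd p.
    apply: contra sp => /mapP[a ap sa]; apply/mapP; exists a => //.
    by rewrite -sa eq_sym (negPf tNs) -sv_eqL eq_sym (negPf tNs').
  have sp2 : sv s \notin map tl p.
    apply: contra s2 => /mapP[a ap sa]; apply/mapP; exists a => //=.
    by rewrite -sa eq_sym (negPf tNs') sv_eq eq_sym (negPf tNs).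
  have [] := IH (shrink_card w pD) (shrink_skew p) (shrink_symm p).
    by case=> q aug; left; apply: shrink_augmenting w r pD sp1 sp2 _ aug.
  by case=> A [l B]; right; apply: shrink_barrier w sp1 sp2 _ _ B.
Qed.

End Step.

Theorem reachability tl hd D : skew_ends tl hd ->
  (forall a, (se a \in D) = (a \in D)) -> dichotomy tl hd D.
Proof.
have [n] := ubnP #|D|; elim: n tl hd D => // n IHn tl hd D ltDn sk DS.
have [/exists_inP[e eD /andP[/eqP tle tNs]]|/exists_inPn iso] :=
  boolP [exists e in D, (tl e == s) && (hd e != s)]; last first.
  apply: dichotomy_isolated => // a aD tla; apply/eqP.
  by have := iso a aD; rewrite tla eqxx negbK.
have [tNs'|tNs'] := eqVneq (hd e) (sv s); last first.
  apply: dichotomy_step sk DS eD tle tNs tNs' _ => tl1 hd1 D1 ltD1 sk1 DS1.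
  by apply: IHn => //; apply: leq_trans ltD1 _.
left; exists [:: e]; split; rewrite /= ?tle ?tNs' ?eqxx //.
- by rewrite /regular /= inE seN.
- by move=> a; rewrite inE => /eqP->.
Qed.

End Reachability.

(** * Counting, and parity of sums over pairs of mates *)

Lemma card_ord_lt (n m : nat) : m <= n -> #|[set i : 'I_n | i < m]| = m.
Proof.
move=> mn; rewrite -sum1_card (eq_bigl (fun i : 'I_n => i < m)) => [|i]; last by rewrite inE.
by rewrite (big_ord_narrow mn) sum1_card card_ord.
Qed.

(** Without fixed points the orbits are pairs; [P] picks one representative of each, and the sums
    are compared pair by pair. *)
Lemma odd_sum_involution (E : finType) (se : E -> E) (g h : E -> nat) :
  (forall a, se a != a) -> involutive se ->
  (forall a, odd (g a + g (se a)) = odd (h a + h (se a))) ->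
  odd (\sum_a g a) = odd (\sum_a h a).
Proof.
move=> seN seK gh; pose P a := enum_rank a < enum_rank (se a).
have split_sum (k : E -> nat) : \sum_a k a = \sum_(a | P a) (k a + k (se a)).
  rewrite (bigID P) big_split /=; congr (_ + _).
  rewrite [RHS](reindex_inj (inv_inj seK)); apply: eq_big => [a|a _]; rewrite /P seK //.
  by rewrite -leqNgt leq_eqVlt (inj_eq val_inj) (inj_eq enum_rank_inj) (negPf (seN a)).
rewrite !split_sum; elim/big_rec2: _ => // a m n _ mn.
by rewrite oddD gh mn -oddD.
Qed.

(** * Symmetric flows across cuts, and their parity *)

Section Flow.

Variables (V E : finType) (tl hd : E -> V) (sv : V -> V) (se : E -> E).
Variables (u : E -> nat) (s : V).
Hypothesis skewG : skew_symmetric tl hd sv se.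
Hypothesis uS : symmetric_fun se u.

Let svN v : sv v != v. Proof. by case: skewG => + _; apply. Qed.
Let svK : involutive sv. Proof. by case: skewG => _ []. Qed.
Let seN a : se a != a. Proof. by case: skewG => _ [_ [+ _]]; apply. Qed.
Let seK : involutive se. Proof. by case: skewG => _ [_ [_ []]]. Qed.
Let tlS a : tl (se a) = sv (hd a).
Proof. by case: skewG => _ [_ [_ [_ /(_ a)[]]]]. Qed.
Let hdS a : hd (se a) = sv (tl a).
Proof. by case: skewG => _ [_ [_ [_ /(_ a)[]]]]. Qed.

Lemma flow_valueE v g : flow_value tl hd v g =
  (\sum_a (g a)%:Z * ((tl a == v)%:Z - (hd a == v)%:Z))%R.
Proof.
under eq_bigr do rewrite mulrBr.
rewrite sumrB /flow_value.
rewrite !(big_morph Posz PoszD (erefl _)) [X in (X - _)%R]big_mkcond.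
rewrite [X in (_ - X)%R]big_mkcond.
by congr (_ - _)%R; apply: eq_bigr => a _; case: eqP; rewrite ?mulr1 ?mulr0.
Qed.

Lemma ucapE (g : E -> nat) (A B : {set V}) :
  ucap tl hd g A B = \sum_a g a * ((tl a \in A) && (hd a \in B)).
Proof. by rewrite /ucap big_mkcond; apply: eq_bigr => a _; case: ifP; rewrite ?muln1 ?muln0. Qed.

Lemma flow_value_sum (g : E -> nat) (A : {set V}) :
  (\sum_(v in A) flow_value tl hd v g)%R =
  ((ucap tl hd g A (~: A))%:Z - (ucap tl hd g (~: A) A)%:Z)%R.
Proof.
under eq_bigr do rewrite flow_valueE.
rewrite exchange_big !ucapE !(big_morph Posz PoszD (erefl _)) -sumrB /=.
apply: eq_bigr => a _; rewrite -mulr_sumr sumrB !inE.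
have mem (v : V) : (\sum_(w in A) (v == w)%:Z)%R = Posz (v \in A).
  rewrite big_mkcond (bigD1 v) //= eqxx big1 ?addr0; first by case: (v \in A).
  by move=> w /negPf wv; rewrite eq_sym wv; case: ifP.
by rewrite !mem !PoszM -mulrBr; case: (tl a \in A); case: (hd a \in A).
Qed.

Section FixedFlow.

Variable f : E -> nat.
Hypothesis fP : is_IS_flow tl hd sv se u s f.

Let f_le a : f a <= u a. Proof. by case: fP => + _; apply. Qed.
Let fS a : f (se a) = f a. Proof. by case: fP => _ [+ _]; apply. Qed.
Let f_cons v : v != s -> v != sv s ->
  \sum_(a | hd a == v) f a = \sum_(a | tl a == v) f a.
Proof. by case: fP => _ [_]; apply. Qed.

Lemma flow_value0 v : v != s -> v != sv s -> flow_value tl hd v f = 0%R.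
Proof. by move=> vs vs'; rewrite /flow_value f_cons // subrr. Qed.

Lemma value_cut (A : {set V}) : s \in A -> sv s \notin A ->
  flow_value tl hd s f =
  ((ucap tl hd f A (~: A))%:Z - (ucap tl hd f (~: A) A)%:Z)%R.
Proof.
move=> sA s'A; rewrite -flow_value_sum (bigD1 s) //= big1 ?addr0 // => v /andP[vA vs].
by apply: flow_value0 => //; apply: contraNneq s'A => <-.
Qed.

(* Conservation on one half [Y] of [X = Y :|: sv @: Y], read modulo 2. *)
Lemma cut_flow_even (A X : {set V}) : s \in A ->
  (forall v, v \in A -> sv v \notin A) -> (forall v, v \in A -> v \notin X) ->
  (forall v, (sv v \in X) = (v \in X)) ->
  (forall a, 0 < u a -> tl a \in X -> [|| hd a \in A, sv (hd a) \in A | hd a \in X]) ->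
  ~~ odd (ucap tl hd f A X + ucap tl hd f X A).
Proof.
move=> sA AA AX XS sep.
pose Y := [set v in X | enum_rank v < enum_rank (sv v)].
have YE v : (v \in Y) + (sv v \in Y) = (v \in X) :> nat.
  rewrite !inE XS svK; case: (v \in X) => //=.
  by case: ltngtP => // /ord_inj/enum_rank_inj/eqP; rewrite eq_sym (negPf (svN v)).
have XA v : v \in X -> v \in A = false by apply: contraTF => /AX.
have sep' a : 0 < u a -> hd a \in X -> [|| tl a \in A, sv (tl a) \in A | tl a \in X].
  move=> ua Xa; have := sep (se a); rewrite uS tlS hdS !XS svK => /(_ ua Xa).
  by case/or3P=> ->; rewrite ?orbT.
pose g a := f a * ((hd a \in Y) + (tl a \in Y)).
pose h a := f a * (((tl a \in A) && (hd a \in X)) + ((tl a \in X) && (hd a \in A))).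
have -> : ucap tl hd f A X + ucap tl hd f X A = \sum_a h a.
  by rewrite !ucapE -big_split; apply: eq_bigr => a _; rewrite /h mulnDr.
rewrite -(odd_sum_involution (g := g) seN seK); last first.
  (* On a pair of mates [g] adds up to [f a] times the number of ends of [a] in [X]. If just one end
     of an arc with flow is in [X], the other is in exactly one of [A] and its mate set, so exactly
     one of the two mates joins [A] and [X]. *)
  move=> a; rewrite /g /h fS tlS hdS !XS -!mulnDr.
  have -> : (hd a \in Y) + (tl a \in Y) + ((sv (tl a) \in Y) + (sv (hd a) \in Y)) =
            (hd a \in X) + (tl a \in X).
    by rewrite -!YE; lia.
  have [->//|fa] := posnP (f a); have ua := leq_trans fa (f_le a).
  rewrite !oddM; congr (_ && _).
  have := sep a ua; have := sep' a ua.
  have := AA (tl a); have := AA (hd a); have := AX (tl a); have := AX (hd a).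
  have := AX (sv (tl a)); have := AX (sv (hd a)); rewrite !XS.
  by do 6![case: (_ \in _)] => //=; do ![move=> /(_ isT) // | move=> _].
(* Neither [s] nor [sv s] is in [X], so inflow equals outflow at every node of [Y]. *)
have -> : \sum_a g a = (\sum_(v in Y) \sum_(a | tl a == v) f a).*2.
  have memY (e : E -> V) : \sum_a f a * (e a \in Y) = \sum_(v in Y) \sum_(a | e a == v) f a.
    rewrite (eq_bigr (fun a => if e a \in Y then f a else 0)); last first.
      by move=> a _; case: ifP; rewrite ?muln1 ?muln0.
    rewrite -big_mkcond (partition_big e (mem Y)) //=.
    by apply: eq_bigr => v Yv; apply: eq_bigl => a; case: eqP => [->|]; rewrite ?Yv ?andbF.
  rewrite -addnn /g (eq_bigr _ (fun a _ => mulnDr _ _ _)) big_split /= !memY.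
  congr (_ + _); apply: eq_bigr => v; rewrite inE => /andP[Xv _].
  apply: f_cons; first by apply: contraTneq Xv => ->; apply: AX.
  by apply: contraTneq Xv => ->; rewrite XS; apply: AX.
by rewrite odd_double.
Qed.

(** * The residual graph with unit arcs *)

Local Notation rarc := (E * bool * 'I_(\sum_a u a))%type.

(* (a, true, i) is a copy of the arc a, (a, false, i) a copy of its reverse. *)
Definition residual_tl (r : rarc) := if r.1.2 then tl r.1.1 else hd r.1.1.
Definition residual_hd (r : rarc) := if r.1.2 then hd r.1.1 else tl r.1.1.
Definition residual_se (r : rarc) := (se r.1.1, r.1.2, r.2).
Definition residual_cap (ab : E * bool) := if ab.2 then u ab.1 - f ab.1 else f ab.1.
(** The index range bounds every residual capacity, so exactly [residual_cap] copies of each arc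
    remain. *)
Definition residual : {set rarc} :=
  [set r : rarc | r.2 < residual_cap r.1].

Definition residual_cut (A X : {set V}) :=
  [set r in residual | (residual_tl r \in A) && (residual_hd r \in X)].

Let u_le a : u a <= \sum_a u a. Proof. by rewrite (bigD1 a) //= leq_addr. Qed.

Lemma residual_cap_le ab : residual_cap ab <= \sum_a u a.
Proof.
apply: leq_trans (u_le ab.1); rewrite /residual_cap.
by case: ab.2; rewrite ?leq_subr ?f_le.
Qed.

Lemma card_residual (P : pred (E * bool)) :
  #|[set r in residual | P r.1]| = \sum_(ab | P ab) residual_cap ab.
Proof.
rewrite -sum1_card (eq_bigl (fun r : rarc => P r.1 && (r.2 < residual_cap r.1))).
  rewrite -(pair_big_dep P (fun ab (i : 'I__) => i < residual_cap ab) (fun _ _ => 1)) /=.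
  apply: eq_bigr => ab _; rewrite sum1_card -[RHS](card_ord_lt (residual_cap_le ab)).
  by rewrite cardsE.
by move=> r; rewrite !inE andbC.
Qed.

(** The residual capacity is u(A,X) - f(A,X) + f(X,A), written here without subtraction. *)
Lemma card_residual_cut (A X : {set V}) :
  #|residual_cut A X| + ucap tl hd f A X = ucap tl hd u A X + ucap tl hd f X A.
Proof.
pose P (ab : E * bool) := if ab.2 then (tl ab.1 \in A) && (hd ab.1 \in X)
                          else (tl ab.1 \in X) && (hd ab.1 \in A).
have -> : residual_cut A X = [set r in residual | P r.1].
  apply/setP=> -[[a b] i]; rewrite !inE /residual_tl /residual_hd /P /=.
  by case: b => //=; rewrite [(hd a \in A) && _]andbC.
rewrite card_residual big_mkcond.
rewrite -(pair_bigA _ (fun a b => if P (a, b) then residual_cap (a, b) else 0)) /=.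
rewrite (eq_bigr (fun a => (u a - f a) * ((tl a \in A) && (hd a \in X)) +
    f a * ((tl a \in X) && (hd a \in A)))); last first.
  by move=> a _; rewrite big_bool /P /residual_cap /=; do 2![case: ifP => _]; rewrite ?muln1 ?muln0.
rewrite big_split /= addnAC -ucapE !ucapE; congr (_ + _).
rewrite -big_split /=; apply: eq_bigr => a _.
by rewrite -mulnDl subnK.
Qed.

Lemma residual_cut_odd (A X : {set V}) : s \in A ->
  (forall v, v \in A -> sv v \notin A) -> (forall v, v \in A -> v \notin X) ->
  (forall v, (sv v \in X) = (v \in X)) ->
  (forall a, 0 < u a -> tl a \in X -> [|| hd a \in A, sv (hd a) \in A | hd a \in X]) ->
  odd #|residual_cut A X| = odd (ucap tl hd u A X).
Proof.
move=> sA AA AX XS sep; have := cut_flow_even sA AA AX XS sep.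
have := congr1 odd (card_residual_cut A X).
by rewrite !oddD; do 4![case: (odd _)].
Qed.

(** * Weak duality *)

Lemma value_residual_cut (A : {set V}) : s \in A -> sv s \notin A ->
  flow_value tl hd s f = ((ucap tl hd u A (~: A))%:Z - #|residual_cut A (~: A)|%:Z)%R.
Proof. by move=> sA s'A; rewrite (value_cut sA s'A); have := card_residual_cut A (~: A); lia. Qed.

(** Conditions (O5) and (O6) are combined into the separation form used by the parity lemmas. *)
Lemma odd_barrier_sep (A : {set V}) k (X : 'I_k -> {set V}) :
  is_odd_barrier tl hd sv u s A X ->
  [/\ s \in A, (forall v, v \in A -> sv v \notin A) & forall i,
    [/\ (forall v, v \in A -> v \notin X i), (forall v, (sv v \in X i) = (v \in X i)) &
     (forall a, 0 < u a -> tl a \in X i ->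
        [|| hd a \in A, sv (hd a) \in A | hd a \in X i])]].
Proof.
case=> sA [AX [XX [AA [XS [_ [O5 O6]]]]]].
have memS (B : {set V}) v : (v \in sv @: B) = (sv v \in B).
  by rewrite -{1}[v]svK (mem_imset _ _ (inv_inj svK)).
split=> // [v vA|i]; first by rewrite -memS (disjointFr AA vA).
split=> [v vA|v|a ua tX]; first by rewrite (disjointFr (AX i) vA).
  by rewrite -{2}[X i]XS memS.
case: (boolP (hd a \in A)) => //= hA; case: (boolP (sv (hd a) \in A)) => //= hA'.
case: (boolP (hd a \in \bigcup_(i < k) X i)) => [/bigcupP[j _ hX]|hX].
  have [<-//|ji] := eqVneq j i.
  by case/existsP: (O5 _ _ ji); exists a; rewrite ua tX hX orbT.
case/existsP: (O6 i); exists a; rewrite ua tX !inE memS.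
by rewrite (negPf hA) (negPf hA') (negPf hX).
Qed.

(** The residual capacity from [A] into each [X i] is odd, hence nonzero. The [X i] being disjoint,
    at least [k] residual arcs leave [A], and their number is the gap between u(A, V - A) and the
    flow value. *)
Lemma weak_duality (A : {set V}) k (X : 'I_k -> {set V}) :
  is_odd_barrier tl hd sv u s A X ->
  (flow_value tl hd s f <= barrier_cap tl hd u A k)%R.
Proof.
move=> B; have [sA AA sep] := odd_barrier_sep B.
case: B => _ [_ [XX [_ [_ [O4 _]]]]].
rewrite (value_residual_cut sA (AA _ sA)) /barrier_cap.
suff: k <= #|residual_cut A (~: A)| by lia.
have ex_arc i : exists r, r \in residual_cut A (X i).
  have [AX XS Xsep] := sep i; apply/card_gt0P.
  by have := O4 i; rewrite -(residual_cut_odd sA AA AX XS Xsep); case: #|_|.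
have [w wP] := fin_all_exists ex_arc.
have w_inj : injective w.
  move=> i j wij; apply/eqP; apply: contraTT (wP j) => /XX/disjointFr ij.
  by move: (wP i); rewrite !inE wij => /and3P[_ _ /ij ->]; rewrite !andbF.
rewrite -[k]card_ord -(card_codom w_inj); apply: subset_leq_card.
apply/subsetP=> _ /codomP[i ->]; move: (wP i); rewrite !inE => /and3P[-> -> iX] /=.
by have [AX _ _] := sep i; apply: contraTN iX => /AX.
Qed.

(** * From a barrier of the residual graph to a tight odd barrier *)

Lemma residual_skew : skew_ends sv residual_se residual_tl residual_hd.
Proof. by case=> [[a []] i]; rewrite /residual_tl /residual_hd /= tlS hdS. Qed.

Lemma residual_symm r : (residual_se r \in residual) = (r \in residual).
Proof. by case: r => [[a []] i]; rewrite !inE /residual_cap /= ?uS fS. Qed.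

Lemma residual_seK : involutive residual_se.
Proof. by case=> [[a b] i]; rewrite /residual_se /= seK. Qed.

Lemma residual_seN r : residual_se r != r.
Proof. by case: r => [[a b] i]; apply: contraNneq (seN a) => -[->]. Qed.

(** A weak barrier constrains residual arcs only; this carries its separation over to all arcs of
    positive capacity, up to direction. *)
Lemma residual_ends a : 0 < u a ->
  exists r, [/\ r \in residual, r.1.1 = a &
   (residual_tl r = tl a /\ residual_hd r = hd a) \/
   (residual_tl r = hd a /\ residual_hd r = tl a)].
Proof.
move=> ua; have n0 := leq_trans ua (u_le a).
have [f0|f_gt0] := posnP (f a).
  by exists (a, true, Ordinal n0); rewrite !inE /residual_cap /= f0 subn0; split=> //; left.
by exists (a, false, Ordinal n0); rewrite !inE /residual_cap /=; split=> //; right.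
Qed.

Lemma tight_barrier A l : weak_barrier sv s residual_tl residual_hd residual A l ->
  exists (A : {set V}) k (X : 'I_k -> {set V}), is_odd_barrier tl hd sv u s A X /\
    flow_value tl hd s f = barrier_cap tl hd u A k.
Proof.
case=> -[As AA] B1 B2 B3 B4.
pose N v := ~~ A v && ~~ A (sv v).
pose A0 := [set v | A v]; pose F := residual_cut A0 (~: A0).
have FP r : r \in F -> [/\ r \in residual, A (residual_tl r) & N (residual_hd r)].
  rewrite /F !inE => /and3P[rD rA rN]; split=> //.
  by rewrite /N rN B1 // inE.
(* One block for each residual arc leaving [A]: by [B4] distinct arcs enter distinct blocks, so the
   number of blocks is the residual capacity out of [A]. *)
pose w (i : 'I_#|F|) := residual_hd (enum_val i).
pose X i := [set v | N v && (l v == l (w i))].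
have wF i : enum_val i \in F := enum_valP i.
have wN i : N (w i) by case: (FP _ (wF i)).
have NS v : N (sv v) = N v by rewrite /N svK andbC.
have XS i v : (sv v \in X i) = (v \in X i).
  by rewrite !inE NS; case: (boolP (N v)) => //= /B3->.
have memS (B : {set V}) v : (v \in sv @: B) = (sv v \in B).
  by rewrite -{1}[v]svK (mem_imset _ _ (inv_inj svK)).
have w_inj i j : l (w i) = l (w j) -> i = j.
  have [iD iA iN] := FP _ (wF i); have [jD jA jN] := FP _ (wF j).
  by move=> lij; apply: enum_val_inj; apply: B4.
have same_l a : 0 < u a -> N (tl a) -> N (hd a) -> l (tl a) = l (hd a).
  move=> ua Nt Nh; have [r [rD _ [[rt rh]|[rt rh]]]] := residual_ends ua.
    by rewrite -rt -rh; apply: B2; rewrite ?rt ?rh.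
  by rewrite -rt -rh; apply/esym; apply: B2; rewrite ?rt ?rh.
have A0N v : v \in A0 -> ~~ N v by rewrite inE /N => ->.
have AA0 v : v \in A0 -> sv v \notin A0 by rewrite !inE; apply: AA.
have sA : s \in A0 by rewrite inE.
exists A0, #|F|, X; split; last first.
  by rewrite (value_residual_cut sA (AA0 _ sA)).
split=> //; split=> [i|].
  rewrite disjoints_subset; apply/subsetP=> v /A0N Nv.
  by rewrite inE inE (negPf Nv).
split=> [i j ij|].
  rewrite disjoints_subset; apply/subsetP=> v; rewrite !inE => /andP[-> /eqP->] /=.
  by apply: contraNneq ij => /w_inj->.
split.
  rewrite disjoints_subset; apply/subsetP=> v /AA0.
  by rewrite in_setC memS.
split=> [i|]; first by apply/setP=> v; rewrite memS XS.
split=> [i|].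
  (* The residual cut into [X i] is the single arc numbered [i], so its size is odd. *)
  rewrite -residual_cut_odd //.
  - suff -> : residual_cut A0 (X i) = [set enum_val i] by rewrite cards1.
    apply/setP=> r; rewrite [in RHS]inE; apply/idP/eqP => [|->].
      rewrite /residual_cut in_set => /and3P[rD]; rewrite !in_set => rA /andP[rN /eqP rl].
      have [iD iA iN] := FP _ (wF i).
      exact: B4.
    by have [iD iA iN] := FP _ (wF i); rewrite !inE in iD *; rewrite iD iA wN eqxx.
  - by move=> v /A0N Nv; rewrite inE (negPf Nv).
  - move=> a ua; rewrite !inE => /andP[Nt /eqP lt].
    have [hA|hA] := boolP (A (hd a)) => //=; have [hA'|hA'] := boolP (A (sv (hd a))) => //=.
    have Nh : N (hd a) by rewrite /N hA hA'.
    by rewrite Nh -lt same_l ?eqxx.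
have sepX i a v w0 : 0 < u a -> (tl a = v /\ hd a = w0) \/ (tl a = w0 /\ hd a = v) ->
    v \in X i -> N w0 -> w0 \in X i.
  move=> ua vw; rewrite !inE => /andP[Nv /eqP lv] Nw; rewrite Nw -lv /=.
  by case: vw => -[tv hw]; have := same_l a ua; rewrite tv hw => -> //.
split=> [i j ij|i].
  apply/existsP=> -[a /andP[ua]].
  have XN v : v \in X j -> N v by rewrite inE => /andP[].
  have abs v : v \in X i -> v \in X j -> False.
    rewrite !inE => /andP[_ /eqP lvi] /andP[_ /eqP lvj].
    by case/eqP: ij; apply: w_inj; rewrite -lvi.
  case/orP=> /andP[tX hX].
    by apply: (abs _ _ hX); apply: (sepX i a _ _ ua _ tX (XN _ hX)); left.
  by apply: (abs _ _ tX); apply: (sepX i a _ _ ua _ hX (XN _ tX)); right.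
have MP v : v \in ~: (A0 :|: (sv @: A0) :|: \bigcup_(i < #|F|) X i) -> N v /\ v \notin X i.
  rewrite !inE memS !negb_or inE => /andP[/andP[vA vA'] vX]; rewrite /N vA vA'; split=> //.
  by apply: contra vX => vX; apply/bigcupP; exists i; rewrite // inE /N vA vA'.
apply/existsP=> -[a /andP[ua]].
case/orP=> /andP[tX hX].
  have [Nh /negP[]] := MP _ hX; by apply: (sepX i a _ _ ua _ tX Nh); left.
have [Nt /negP[]] := MP _ tX; by apply: (sepX i a _ _ ua _ hX Nt); right.
Qed.

(** * Augmenting along a regular walk and its mate *)

Section Augment.

Variable p : seq rarc.
Hypothesis augp : augmenting sv residual_se s residual_tl residual_hd residual p.

(** Using the mates as well keeps the flow symmetric and doubles the gain. *)
Let q := p ++ map residual_se p.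
Let used ab := count (fun r : rarc => r.1 == ab) q.

(** The truncated subtraction is exact, by [used_le]. *)
Definition augmented a := f a + used (a, true) - used (a, false).

Let residual_se_inj : injective residual_se := inv_inj residual_seK.

Let q_uniq : uniq q.
Proof.
case: augp => _ /regularP[up mp] _; rewrite cat_uniq up map_inj_uniq // up andbT.
by apply/hasPn=> _ /mapP[r rp ->]; apply: mp.
Qed.

Let q_sub : {subset q <= residual}.
Proof.
case: augp => _ _ pD r; rewrite mem_cat => /orP[/pD //|/mapP[r' /pD r'D ->]].
by rewrite residual_symm.
Qed.

(** By regularity [q] repeats no copy, so its copies of [ab] have distinct indices, all below the
    residual capacity. *)
Let used_le ab : used ab <= residual_cap ab.
Proof.
rewrite /used -size_filter -[size _](size_map (fun r : rarc => val r.2)) -[leqRHS](size_iota 0).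
apply: uniq_leq_size => [|j].
  rewrite map_inj_in_uniq ?filter_uniq // => -[r1 i1] [r2 i2]; rewrite !mem_filter /=.
  by move=> /andP[/eqP-> _] /andP[/eqP-> _] /val_inj->.
case/mapP=> r; rewrite mem_filter => /andP[/eqP rab /q_sub]; rewrite inE rab => rl ->.
by rewrite mem_iota.
Qed.

Let used_symm a b : used (se a, b) = used (a, b).
Proof.
rewrite /used !count_cat !count_map addnC.
by congr (_ + _); apply: eq_count => -[[a' b'] i];
  rewrite /= !xpair_eqE ?(inj_eq (inv_inj seK)) // (can2_eq seK seK).
Qed.

Let augmentedE a :
  Posz (augmented a) = (Posz (f a) + \sum_(r <- q | r.1.1 == a) (if r.1.2 then 1 else -1))%R.
Proof.
have -> : (\sum_(r <- q | r.1.1 == a) (if r.1.2 then 1 else -1) =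
           (used (a, true))%:Z - (used (a, false))%:Z)%R.
  rewrite /used; elim: q => [|[[a' b] i] q' IHq]; first by rewrite big_nil.
  rewrite big_cons /= IHq !xpair_eqE; case: eqP => _ //=.
  by case: b; lia.
by rewrite /augmented; have := used_le (a, false); rewrite /residual_cap /=; lia.
Qed.

Let walk_net x y v (p' : seq rarc) : walk residual_tl residual_hd x p' y ->
  (\sum_(r <- p') ((residual_tl r == v)%:Z - (residual_hd r == v)%:Z) =
   (x == v)%:Z - (y == v)%:Z)%R.
Proof.
elim: p' x => [x /eqP->|r p' IHp x /= /andP[/eqP<- /IHp IH]]; first by rewrite big_nil subrr.
by rewrite big_cons IH; ring.
Qed.

(** The mate of the walk, reversed, also runs from [s] to [sv s]; the net outflow telescopes along
    each of the two walks, whence the factor 2. *)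
Lemma augmented_flow_value v :
  flow_value tl hd v augmented =
  (flow_value tl hd v f + ((s == v)%:Z - (sv s == v)%:Z) *+ 2)%R.
Proof.
case: augp => wp _ _.
have wp' := walk_mate residual_skew wp; rewrite svK in wp'.
have <- : (\sum_(r <- q) ((residual_tl r == v)%:Z - (residual_hd r == v)%:Z) =
          ((s == v)%:Z - (sv s == v)%:Z) *+ 2)%R.
  rewrite big_cat (walk_net v wp) mulr2n -{3}(walk_net v wp').
  by congr (_ + _)%R; apply/perm_big; rewrite perm_sym perm_rev.
rewrite [LHS]flow_valueE (eq_bigr _ (fun a _ => congr1 (fun z => z * _)%R (augmentedE a))).
rewrite (eq_bigr _ (fun a _ => mulrDl _ _ _)) big_split -flow_valueE /=; congr (_ + _)%R.
under eq_bigr do rewrite mulr_suml.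
rewrite (exchange_big_dep xpredT) //=; apply: eq_bigr => r _.
rewrite (big_pred1 r.1.1) => [|a]; last by rewrite /= eq_sym.
by rewrite /residual_tl /residual_hd; case: r.1.2; rewrite ?mul1r // mulN1r opprB.
Qed.

Lemma augmented_IS_flow : is_IS_flow tl hd sv se u s augmented.
Proof.
split=> [a|]; last split=> [a|v vs vs'].
- have := used_le (a, true); have := used_le (a, false); rewrite /residual_cap /augmented /=.
  by have := f_le a; lia.
- by rewrite /augmented !used_symm fS.
- have := augmented_flow_value v; rewrite [flow_value _ _ _ f]flow_value0 //.
  rewrite ![_ == v]eq_sym (negPf vs) (negPf vs') /flow_value /=.
  by lia.
Qed.

Lemma augmented_value : flow_value tl hd s augmented = (flow_value tl hd s f + 2)%R.
Proof. by rewrite augmented_flow_value eqxx (negPf (svN s)). Qed.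

End Augment.

End FixedFlow.

(** * Termination of augmentation and the min-max equality *)

Lemma flow_value_bound f : is_IS_flow tl hd sv se u s f ->
  (flow_value tl hd s f <= (\sum_a u a)%:Z)%R.
Proof.
case=> f_le _; rewrite /flow_value.
have : \sum_(a | tl a == s) f a <= \sum_a u a.
  rewrite big_mkcond; apply: leq_sum => a _; case: ifP => // _; exact: f_le.
by lia.
Qed.

(** Start from the zero flow and augment until a barrier appears. The induction is on a bound [n]
    for the total capacity minus the flow value, which drops by 2 each time. *)
Lemma max_flow_min_barrier : exists f (A : {set V}) k (X : 'I_k -> {set V}),
  [/\ is_IS_flow tl hd sv se u s f, is_odd_barrier tl hd sv u s A X &
       flow_value tl hd s f = barrier_cap tl hd u A k].
Proof.
suff gen n f : is_IS_flow tl hd sv se u s f ->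
    ((\sum_a u a)%:Z - flow_value tl hd s f <= n%:Z)%R ->
    exists f (A : {set V}) k (X : 'I_k -> {set V}),
      [/\ is_IS_flow tl hd sv se u s f, is_odd_barrier tl hd sv u s A X &
          flow_value tl hd s f = barrier_cap tl hd u A k].
  apply: (gen (\sum_a u a) (fun=> 0)).
    by split=> //; split=> // v _ _; rewrite !big1.
  have -> : flow_value tl hd s (fun=> 0) = 0%R by rewrite /flow_value !big1.
  by lia.
elim: n f => [|n IHn] f fP le_n.
all: have [[p augp]|[A [l B]]] := reachability s svN svK residual_seN
    residual_seK residual_skew (residual_symm fP).
all: try by have [A0 [k [X [B0 eqv]]]] := tight_barrier fP B; exists f, A0, k, X.
  (* With no gap left, an augmentation would exceed the total capacity. *)
  have := flow_value_bound (augmented_IS_flow fP augp).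
  by rewrite augmented_value //; lia.
apply: (IHn _ (augmented_IS_flow fP augp)).
by rewrite augmented_value //; lia.
Qed.

End Flow.

Local Open Scope ring_scope.

Theorem mainTheorem6 (V E : finType) (tl hd : E -> V) (sv : V -> V) (se : E -> E)
    (u : E -> nat) (s : V) :
  skew_symmetric tl hd sv se -> symmetric_fun se u ->
  (forall (f : E -> nat) (A : {set V}) (k : nat) (X : 'I_k -> {set V}),
      is_IS_flow tl hd sv se u s f -> is_odd_barrier tl hd sv u s A X ->
      flow_value tl hd s f <= barrier_cap tl hd u A k) /\
  (exists (f : E -> nat) (A : {set V}) (k : nat) (X : 'I_k -> {set V}),
      [/\ is_IS_flow tl hd sv se u s f, is_odd_barrier tl hd sv u s A X &
          flow_value tl hd s f = barrier_cap tl hd u A k]).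
Proof.
move=> skewG uS; split; last exact: max_flow_min_barrier skewG uS.
move=> f A k X fP B; exact: (weak_duality skewG uS fP B).
Qed.
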